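(* Let $K\in L_0(\Omega\times\Omega')$ be a generalized Mercer kernel, $K(x,y)=\sum_{n\in\mathbb{N}}\phi_n(x)\phi_n'(y)$ (pointwise convergent), whose expansion sets $\{\phi_n:n\in\mathbb{N}\}\subseteq L_0(\Omega)$ and $\{\phi_n':n\in\mathbb{N}\}\subseteq L_0(\Omega')$ are linearly independent and satisfy $$\sum_{n\in\mathbb{N}}|\phi_n(x)|<\infty\ \text{ for all }x\in\Omega,\qquad\sum_{n\in\mathbb{N}}|\phi_n'(y)|<\infty\ \text{ for all }y\in\Omega'.$$ Let $K'(y,x):=K(x,y)$ for $x\in\Omega$, $y\in\Omega'$ be the adjoint kernel of $K$. Then the space $$\mathcal{B}_{K'}^\infty(\Omega'):=\Big\{g=\sum_{n\in\mathbb{N}}b_n\phi_n':(b_n)_{n\in\mathbb{N}}\in c_0\Big\},\qquad\|g\|_{\mathcal{B}_{K'}^\infty(\Omega')}:=\sup_{n\in\mathbb{N}}|b_n|,$$ is a two-sided reproducing kernel Banach space (of functions on $\Omega'$) with the two-sided reproducing kernel $K'\in L_0(\Omega'\times\Omega)$.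
   Context: $\Omega,\Omega'$ are locally compact Hausdorff spaces equipped with regular Borel measures $\mu,\mu'$. $L_0(X)$ denotes the set of real-valued measurable functions on $X$ (genuine functions). A set (here: countable family) of functions is linearly independent if no nontrivial finite linear combination of distinct members vanishes. $c_0$ is the space of real sequences converging to $0$ with the sup norm. The norm of $\mathcal{B}_{K'}^\infty(\Omega')$ is taken to be well defined in terms of the coefficients $(b_n)$; the series defining $g$ converge pointwise. Two-sided reproducing kernel Banach space (general definition, for locally compact Hausdorff spaces $X,X'$ with regular Borel measures and a kernel $W\in L_0(X\times X')$): let $\mathcal{B}$ be a Banach space consisting of functions in $L_0(X)$ whose continuous dual $\mathcal{B}'$ is isometrically isomorphic to a normed space $\mathcal{F}$ consisting of functions in $L_0(X')$, identified with $\mathcal{B}'$; write $\langle f,G\rangle_{\mathcal{B}}:=G(f)$. $\mathcal{B}$ is a two-sided reproducing kernel Banach space with two-sided reproducing kernel $W$ if (i) $W(x,\cdot)\in\mathcal{F}\cong\mathcal{B}'$ for each $x\in X$; (ii) $\langle f,W(x,\cdot)\rangle_{\mathcal{B}}=f(x)$ for all $f\in\mathcal{B}$, $x\in X$; (iii) $W(\cdot,y)\in\mathcal{B}$ for each $y\in X'$; (iv) $\langle W(\cdot,y),g\rangle_{\mathcal{B}}=g(y)$ for all $g\in\mathcal{F}$, $y\in X'$. In the claim this is applied with $X=\Omega'$, $X'=\Omega$, $W=K'$.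
   Formalization: The formal theorem also assumes that any two absolutely summable coefficient sequences expanding the same function along the φ_n have the same ℓ^1 norm; without this the claim is false, since a nonzero dual functional could be the zero function. *)

(* Defs.v *)
From HB Require Import structures.
From mathcomp Require Import all_boot all_order all_algebra.
From mathcomp Require Import all_classical all_reals all_analysis.
Set Implicit Arguments.
Unset Strict Implicit.
Unset Printing Implicit Defensive.
Import Order.TTheory GRing.Theory Num.Theory.
Import numFieldNormedType.Exports.
Local Open Scope classical_set_scope.
Local Open Scope ring_scope.

Notation borel T := (g_sigma_algebraType (@open T)).

(* On a Hausdorff space compact sets are closed, hence Borel, so every value
   of [mu] below is taken on a Borel set. *)
Definition regular_measure (R : realType) (T : ptopologicalType)
    (mu : {measure set (borel T) -> \bar R}) : Prop :=
  [/\ forall C : set T, compact C -> (mu C < +oo)%E,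
      forall A : set (borel T), measurable A ->
        mu A = ereal_inf [set mu U | U in [set U : set T | open U /\ A `<=` U]]
    & forall U : set T, open U ->
        mu U = ereal_sup [set mu C | C in [set C : set T | compact C /\ C `<=` U]]].

Definition L0 (R : realType) (T : ptopologicalType) : set (T -> R) :=
  [set f | measurable_fun [set: borel T] (f : borel T -> R)].

(* [borel S * borel T] carries the product sigma-algebra. *)
Definition L0_prod (R : realType) (S T : ptopologicalType) :
    set (S * T -> R) :=
  [set f | measurable_fun [set: borel S * borel T]
             (f : borel S * borel T -> R)].

Definition linearly_independent (R : realType) (T : Type)
    (psi : nat -> T -> R) : Prop :=
  forall (N : nat) (c : nat -> R),
    \sum_(n < N) c n *: (psi n : T -> R^o) = 0 ->
    forall n, (n < N)%N -> c n = 0.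

Definition expands (R : realType) (T : Type) (psi : nat -> T -> R)
    (a : nat -> R) (g : T -> R) : Prop :=
  forall t, series (fun n => a n * psi n t) @ \oo --> g t.

Definition c0 (R : realType) : set (nat -> R) :=
  [set b : nat -> R | b @ \oo --> (0 : R)].

Definition sup_norm (R : realType) (b : nat -> R) : R :=
  sup (range (fun n => `|b n|)).

Definition ell1 (R : realType) : set (nat -> R) :=
  [set a : nat -> R | cvgn [normed series a]].

Definition ell1_norm (R : realType) (a : nat -> R) : R :=
  limn [normed series a].

(* The functions with an expansion whose coefficients lie in [A], normed by
   [p] of the coefficients. Finite linear independence of [psi] does not make
   infinite expansions unique, so [expansion_norm] chooses coefficients; it is
   meaningful when [norm_well_defined] holds. In a two-sided RKBS on
   [Binf phi'], the pairing identities force the dual to consist of the [ell1]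
   expansions along [phi], whose norm must be well defined as well. *)
Definition expansion_space (R : realType) (T : Type) (psi : nat -> T -> R)
    (A : set (nat -> R)) : set (T -> R) :=
  [set g | exists2 a, A a & expands psi a g].

Definition expansion_norm (R : realType) (T : Type) (psi : nat -> T -> R)
    (A : set (nat -> R)) (p : (nat -> R) -> R) (g : T -> R) : R :=
  p (xget (fun=> 0) [set a | A a /\ expands psi a g]).

Definition norm_well_defined (R : realType) (T : Type) (psi : nat -> T -> R)
    (A : set (nat -> R)) (p : (nat -> R) -> R) : Prop :=
  forall a a' g, A a -> A a' -> expands psi a g -> expands psi a' g ->
    p a = p a'.

Definition Binf (R : realType) (T : Type) (psi : nat -> T -> R) :
    set (T -> R) := expansion_space psi (@c0 R).

Definition Binf_norm (R : realType) (T : Type) (psi : nat -> T -> R) :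
    (T -> R) -> R := expansion_norm psi (@c0 R) (@sup_norm R).

Definition generalized_mercer (R : realType) (S T : ptopologicalType)
    (K : S * T -> R) (phi : nat -> S -> R) (phi' : nat -> T -> R) : Prop :=
  [/\ L0_prod K, forall n, L0 (phi n), forall n, L0 (phi' n)
    & forall x y, series (fun n => phi n x * phi' n y) @ \oo --> K (x, y)].

Definition adjoint_kernel (R : realType) (S T : Type) (K : S * T -> R) :
  T * S -> R := fun z => K (z.2, z.1).

Definition continuous_dual (R : realType) (V : normedModType R) :
    set (V -> R) :=
  [set G | linear (G : V -> R^o) /\ continuous G].

Definition dual_norm (R : realType) (V : normedModType R) (G : V -> R) : R :=
  sup [set `|G v| | v in [set v : V | `|v| <= 1]].

Definition dual_isometry (R : realType) (F V : normedModType R)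
    (T : F -> V -> R) : Prop :=
  [/\ linear (T : F -> V -> R^o), range T = @continuous_dual R V
    & forall g, dual_norm (T g) = `|g|].

(* The normed space [V] consists of functions in [L0 X]: [ev v] is the vector
   [v] regarded as a function. *)
Definition function_space (R : realType) (X : ptopologicalType)
    (V : normedModType R) (ev : V -> X -> R) : Prop :=
  [/\ linear (ev : V -> X -> R^o), injective ev & range ev `<=` @L0 R X].

(* The set of functions [B] with norm [N] is a Banach space [V] (through the
   evaluation [ev]), its dual is identified through [T] with a normed space
   [F] of functions on [X'], and [T g f] is the pairing <f, g>. *)
Definition two_sided_RKBS (R : realType) (X X' : ptopologicalType)
    (B : set (X -> R)) (N : (X -> R) -> R) (W : X * X' -> R) : Prop :=
  L0_prod W /\
  exists (V : completeNormedModType R) (ev : V -> X -> R),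
    [/\ function_space ev, range ev = B, forall f, `|f| = N (ev f) &
    exists (F : normedModType R) (ev' : F -> X' -> R) (T : F -> V -> R),
      [/\ function_space ev', dual_isometry T &
      [/\ (forall x, exists g, ev' g = (fun y => W (x, y))),
          (forall x g, ev' g = (fun y => W (x, y)) ->
             forall f, T g f = ev f x),
          (forall y, exists f, ev f = (fun x => W (x, y)))
        & (forall y f, ev f = (fun x => W (x, y)) ->
             forall g, T g f = ev' g y)]]].

(* Main.v *)
(* The space is a copy of c_0 and its dual a copy of l^1: the pairing
   <f, g> = \sum_n a_n b_n of g = \sum_n a_n phi_n (a in l^1) with
   f = \sum_n b_n phi'_n (b in c_0) specializes, when g = K(., y), that is
   a_n = phi'_n(y), to f(y), and, when f = K(x, .), that is b_n = phi_n(x),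
   to g(x). Coefficients are determined by the function because the norms are
   well defined: the difference of two expansions of the same function expands
   0, so its norm is that of the zero sequence. For the duality c_0' = l^1, a
   continuous functional G is determined by a_n = G(e_n), as truncations
   converge in c_0, and testing G on the truncated sign sequences of a bounds
   the partial sums of |a_n| by the norm of G. *)

Require Import Defs.
From HB Require Import structures.
From mathcomp Require Import all_boot all_order all_algebra.
From mathcomp Require Import all_classical all_reals all_analysis.
From mathcomp Require Import measurable_realfun.
Import Order.TTheory GRing.Theory Num.Theory.
Import numFieldNormedType.Exports.
Local Open Scope classical_set_scope.
Local Open Scope ring_scope.

(** * The sup norm on $c_0$ and the $\ell^1$ norm, on plain sequences *)

Section sequence_norms.
Context {R : realType}.
Implicit Types a b : nat -> R.

Lemma c0_has_sup b : c0 b -> has_sup (range (fun n => `|b n|)).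
Proof.
move=> b0; split; first by exists `|b 0%N|, 0%N.
have /cvg_seq_bounded/bounded_fun_has_ubound[M bM] : cvgn (fun n => `|b n|).
  by apply: is_cvg_norm; apply: cvgP b0.
by exists M.
Qed.

Lemma ler_sup_norm b n : c0 b -> `|b n| <= sup_norm b.
Proof. by move=> /c0_has_sup[_ bM]; apply: ub_le_sup => //; exists n. Qed.

Lemma sup_norm_le b (M : R) : (forall n, `|b n| <= M) -> sup_norm b <= M.
Proof.
move=> bM; apply: ge_sup; first by exists `|b 0%N|, 0%N.
by move=> _ [n _ <-].
Qed.

Lemma sup_norm0_eq0 b : c0 b -> sup_norm b = 0 -> b = 0.
Proof.
move=> b0 bE; apply/funext => n; apply/eqP.
by rewrite -normr_le0 -bE ler_sup_norm.
Qed.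

Lemma sup_normZ (k : R) b : c0 b -> sup_norm (k *: b) = `|k| * sup_norm b.
Proof.
move=> b0; have kb0 : c0 (k *: b).
  by rewrite /c0 /= -(mulr0 k); apply: cvgM b0; exact: cvg_cst.
apply/eqP; rewrite eq_le; apply/andP; split.
  by apply: sup_norm_le => n; rewrite normrM ler_wpM2l // ler_sup_norm.
(* The reverse bound divides by [|k|], so the zero scalar is treated apart. *)
have [->|k0] := eqVneq k 0.
  rewrite normr0 mul0r scale0r.
  by rewrite (le_trans (normr_ge0 _) (ler_sup_norm _ 0%N _)) //; exact: cvg_cst.
rewrite -ler_pdivlMl ?normr_gt0 //; apply: sup_norm_le => n.
by rewrite ler_pdivlMl ?normr_gt0 // -normrM (ler_sup_norm _ _ kb0).
Qed.

Lemma sup_normD b b' : c0 b -> c0 b' ->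
  sup_norm (b + b') <= sup_norm b + sup_norm b'.
Proof.
move=> b0 b'0; apply: sup_norm_le => n.
by rewrite (le_trans (ler_normD _ _)) // lerD // ler_sup_norm.
Qed.

Lemma normed_series_le a n : ell1 a ->
  series (fun k => `|a k|) n <= ell1_norm a.
Proof.
move=> a1; apply: nondecreasing_cvgn_le => //.
exact: nondecreasing_series.
Qed.

(** Partial sums of absolute values are monotone, so a uniform bound gives convergence and bounds
    the limit. Both conclusions come together because each later use of it builds an $\ell^1$
    sequence and estimates its norm at once. *)
Lemma normed_series_ub a (M : R) :
  (forall n, series (fun k => `|a k|) n <= M) -> ell1 a /\ ell1_norm a <= M.
Proof.
move=> aM; have a1 : ell1 a.
  apply: (@nondecreasing_is_cvgn _ (series (fun k => `|a k|))).
    exact: nondecreasing_series.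
  by exists M => _ [n _ <-]; exact: aM.
by split => //; apply: limr_le => //; exact: nearW.
Qed.

Lemma ell1_norm0_eq0 a : ell1 a -> ell1_norm a = 0 -> a = 0.
Proof.
move=> a1 aE; apply/funext => n; apply/eqP.
(* The partial sum up to [n.+1] is the first that contains the term [a n]. *)
rewrite -normr_le0 -aE (le_trans _ (normed_series_le _ n.+1 a1)) //.
by rewrite /series /= big_nat_recr //= lerDr sumr_ge0.
Qed.

Lemma ell1D a a' : ell1 a -> ell1 a' ->
  ell1 (a + a') /\ ell1_norm (a + a') <= ell1_norm a + ell1_norm a'.
Proof.
move=> a1 a'1; apply: normed_series_ub => n.
apply: le_trans (lerD (normed_series_le _ n a1) (normed_series_le _ n a'1)).
by rewrite /series /= -big_split ler_sum // => k _; exact: ler_normD.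
Qed.

Lemma normed_seriesZ (k : R) a :
  [normed series (k *: a)] = `|k| *: [normed series a].
Proof.
apply/funext => n; rewrite -[RHS]/(`|k| * \sum_(0 <= i < n) `|a i|) mulr_sumr.
by apply: eq_bigr => i _; rewrite -normrM.
Qed.

Lemma ell1Z (k : R) a : ell1 a -> ell1 (k *: a).
Proof. by move=> a1; rewrite /ell1 /= normed_seriesZ; exact: is_cvgZl_tmp. Qed.

Lemma ell1_normZ (k : R) a : ell1 a -> ell1_norm (k *: a) = `|k| * ell1_norm a.
Proof. by move=> a1; rewrite /ell1_norm normed_seriesZ; exact: limZl_tmp. Qed.

Lemma ell1_c0 : @ell1 R `<=` @c0 R.
Proof. by move=> a a1; apply/cvg_series_cvg_0/normed_cvg. Qed.

End sequence_norms.

(** * $c_0$ and $\ell^1$ as normed spaces; completeness of $c_0$ *)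

Section sequence_spaces.
Variable R : realType.

Definition c0_pred : {pred nat -> R} := mem (@c0 R).
Definition ell1_pred : {pred nat -> R} := mem (@ell1 R).

Let c0_predE b : (b \in c0_pred) = `[< c0 b >]. Proof. by []. Qed.
Let ell1_predE a : (a \in ell1_pred) = `[< ell1 a >]. Proof. by []. Qed.

Fact c0_submod_closed : submod_closed c0_pred.
Proof.
split=> [|k b b']; rewrite !c0_predE.
  by apply/asboolP; exact: cvg_cst.
move=> /asboolP b0 /asboolP b'0; apply/asboolP.
suff : (fun n => k * b n + b' n) @ \oo --> k * 0 + 0 by rewrite mulr0 addr0.
by apply: cvgD b'0; apply: cvgM b0; exact: cvg_cst.
Qed.

Fact ell1_submod_closed : submod_closed ell1_pred.
Proof.
split=> [|k a a']; rewrite !ell1_predE.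
  apply/asboolP.
  suff /normed_series_ub[] :
    forall n, series (fun k => `|(0 : nat -> R) k|) n <= 0 by [].
  by move=> n; rewrite /series /= big1 // => k _; rewrite normr0.
move=> /asboolP a1 /asboolP a'1; apply/asboolP.
by have [] := ell1D (k *: a) a' (ell1Z k _ a1) a'1.
Qed.

HB.instance Definition _ :=
  GRing.isSubmodClosed.Build R (nat -> R) c0_pred
    c0_submod_closed.
HB.instance Definition _ :=
  GRing.isSubmodClosed.Build R (nat -> R) ell1_pred
    ell1_submod_closed.

(** Separate carrier types, so that each space gets the topology of its own norm. *)
Record c0_seq := C0Seq
  { c0_val :> nat -> R; _ : c0_val \in c0_pred }.
Record ell1_seq := Ell1Seq
  { ell1_val :> nat -> R; _ : ell1_val \in ell1_pred }.

HB.instance Definition _ := [isSub for c0_val].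
HB.instance Definition _ := [Choice of c0_seq by <:].
HB.instance Definition _ := [SubChoice_isSubLmodule of c0_seq by <:].
HB.instance Definition _ := [isSub for ell1_val].
HB.instance Definition _ := [Choice of ell1_seq by <:].
HB.instance Definition _ := [SubChoice_isSubLmodule of ell1_seq by <:].

Lemma c0_seqP (b : c0_seq) : c0 (b : nat -> R).
Proof. exact: asboolW (valP b). Qed.

Lemma ell1_seqP (a : ell1_seq) : ell1 (a : nat -> R).
Proof. exact: asboolW (valP a). Qed.

Fact c0_ler_normD (x y : c0_seq) :
  sup_norm (x + y : c0_seq) <= sup_norm x + sup_norm y.
Proof. exact: sup_normD (c0_seqP x) (c0_seqP y). Qed.

Fact c0_normrZ (k : R) (x : c0_seq) :
  sup_norm (k *: x : c0_seq) = `|k| * sup_norm x.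
Proof. exact: sup_normZ (c0_seqP x). Qed.

Fact c0_normr0_eq0 (x : c0_seq) : sup_norm x = 0 -> x = 0.
Proof. by move=> x0; apply/val_inj; exact: sup_norm0_eq0 (c0_seqP x) x0. Qed.

HB.instance Definition _ := Lmodule_isNormed.Build R c0_seq
  c0_ler_normD c0_normrZ c0_normr0_eq0.

Fact ell1_ler_normD (x y : ell1_seq) :
  ell1_norm (x + y : ell1_seq) <= ell1_norm x + ell1_norm y.
Proof. by have [] := ell1D _ _ (ell1_seqP x) (ell1_seqP y). Qed.

Fact ell1_normrZ (k : R) (x : ell1_seq) :
  ell1_norm (k *: x : ell1_seq) = `|k| * ell1_norm x.
Proof. exact: ell1_normZ (ell1_seqP x). Qed.

Fact ell1_normr0_eq0 (x : ell1_seq) : ell1_norm x = 0 -> x = 0.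
Proof. by move=> x0; apply/val_inj; exact: ell1_norm0_eq0 (ell1_seqP x) x0. Qed.

HB.instance Definition _ := Lmodule_isNormed.Build R ell1_seq
  ell1_ler_normD ell1_normrZ ell1_normr0_eq0.

Lemma ler_c0_norm (b : c0_seq) n : `|b n| <= `|b|.
Proof. exact: ler_sup_norm (c0_seqP b). Qed.

Fact c0_complete (F : set_system c0_seq) :
  ProperFilter F -> cauchy F -> cvg F.
Proof.
move=> FF Fc.
have Fball e : 0 < e -> exists x : c0_seq, F (ball x e).
  exact: (cauchyP F).1 Fc e.
(* The candidate limit is taken coordinatewise: each coordinate is 1-Lipschitz for the sup norm, so
   it maps [F] to a Cauchy filter on the reals. *)
pose l n : R := lim ((b : c0_seq) n @[b --> F]).
have cvgl n : (b : c0_seq) n @[b --> F] --> l n.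
  apply: cauchy_cvg; apply: cauchy_exP => e e0.
  have [x Fx] := Fball e e0; exists (x n).
  suff : F [set b : c0_seq | `|x n - b n| < e] by [].
  apply: filterS Fx => b.
  rewrite -ball_normE /= => xb.
  exact: le_lt_trans (ler_c0_norm (x - b) n) xb.
(* The bound on [x n - b n] holds for [F]-almost all [b] and passes to the limit in [b], uniformly
   in [n]. *)
have near_l e : 0 < e ->
    exists2 x : c0_seq, F (ball x e) & forall n, `|x n - l n| <= e.
  move=> e0; have [x Fx] := Fball e e0; exists x => // n.
  have cxl : x n - (b : c0_seq) n @[b --> F] --> x n - l n.
    by apply: cvgB => //; exact: cvg_cst.
  have <- : lim (`|x n - (b : c0_seq) n| @[b --> F]) = `|x n - l n|.
    by apply: cvg_lim => //; exact: cvg_norm cxl.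
  apply: limr_le; first by apply: is_cvg_norm; apply: cvgP cxl.
  apply: filterS Fx => b; rewrite -ball_normE /= => /ltW.
  exact: le_trans (ler_c0_norm (x - b) n).
(* A sequence uniformly within [e / 2] of a null sequence is eventually bounded by [e]. *)
have l0 : l \in c0_pred.
  apply/asboolP/cvgr0Pnorm_le => e e0.
  have e20 : 0 < e / 2 by rewrite divr_gt0.
  have [x _ xl] := near_l _ e20.
  have := c0_seqP x => /cvgr0Pnorm_le /(_ _ e20); apply: filterS => n xn.
  rewrite -[l n](subKr (x n)) (le_trans (ler_normB _ _)) //.
  by rewrite (splitr e) lerD.
apply: (@cvgP _ _ (C0Seq l l0)); apply/cvgrPdist_le => e e0.
have e20 : 0 < e / 2 by rewrite divr_gt0.
have [x Fx xl] := near_l _ e20; apply: filterS Fx => b.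
rewrite -ball_normE /= => xb.
rewrite -(subrKA x) (splitr e) (le_trans (ler_normD _ _)) //.
rewrite lerD //; last exact: ltW.
by apply: sup_norm_le => n; rewrite distrC; exact: xl.
Qed.

HB.instance Definition _ := Uniform_isComplete.Build c0_seq c0_complete.

End sequence_spaces.

(** * The pairing of two sequences *)

Definition pairing {R : realType} (a b : nat -> R) : R :=
  limn (series (fun n => a n * b n)).

Section pairing_theory.
Context {R : realType}.
Implicit Types a b : nat -> R.

(** The Hölder inequality for exponents 1 and infinity, applied to partial sums. *)
Lemma ell1M a b : ell1 a -> c0 b ->
  ell1 (fun n => a n * b n) /\
  ell1_norm (fun n => a n * b n) <= ell1_norm a * sup_norm b.
Proof.
move=> a1 b0; apply: normed_series_ub => n.
have b_ge0 : 0 <= sup_norm b := le_trans (normr_ge0 _) (ler_sup_norm b 0%N b0).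
apply: le_trans (ler_wpM2r b_ge0 (normed_series_le _ n a1)).
rewrite /series /= mulr_suml ler_sum // => k _.
by rewrite normrM ler_wpM2l // ler_sup_norm.
Qed.

Lemma cvg_pairing a b : ell1 a -> c0 b ->
  series (fun n => a n * b n) @ \oo --> pairing a b.
Proof. by move=> a1 b0; apply: normed_cvg; have [] := ell1M _ _ a1 b0. Qed.

Lemma ler_pairing a b : ell1 a -> c0 b ->
  `|pairing a b| <= ell1_norm a * sup_norm b.
Proof.
move=> a1 b0; have [ab1 ab_le] := ell1M _ _ a1 b0.
exact: le_trans (lim_series_norm ab1) ab_le.
Qed.

Lemma series_mulC a b :
  series (fun n => a n * b n) = series (fun n => b n * a n).
Proof. by congr series; apply/funext => n; rewrite mulrC. Qed.

Lemma pairingC a b : pairing a b = pairing b a.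
Proof. by rewrite /pairing series_mulC. Qed.

(** Stated under convergence alone, it serves for linearity in either argument of the duality
    (through [pairingC]) and for the pointwise evaluation of expansions. *)
Lemma pairing_linear k a a' b :
  cvgn (series (fun n => a n * b n)) -> cvgn (series (fun n => a' n * b n)) ->
  pairing (k *: a + a') b = k * pairing a b + pairing a' b.
Proof.
move=> ab a'b; apply: cvg_lim => //.
rewrite (_ : series _ = (fun n => k * series (fun i => a i * b i) n
                               + series (fun i => a' i * b i) n)).
  by apply: cvgD a'b; apply: cvgM ab; exact: cvg_cst.
apply/funext => n; rewrite /series /= mulr_sumr -big_split /=.
by apply: eq_bigr => i _; rewrite mulrDl -mulrA.
Qed.

End pairing_theory.

(** * The isometry of $\ell^1$ with the dual of $c_0$ *)

Section c0_dual.
Variable R : realType.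
Implicit Types (a : ell1_seq R) (b : c0_seq R) (f : nat -> R).

Fact c0_trunc_subproof N f :
  (fun n => if (n < N)%N then f n else 0) \in @c0_pred R.
Proof.
apply/asboolP; rewrite /c0 /=; apply: cvg_near_cst; exists N => // n /= Nn.
by rewrite ltnNge Nn.
Qed.

Definition c0_trunc N f : c0_seq R := C0Seq _ _ (c0_trunc_subproof N f).
(** The unit vector $e_n$. Cutting at [n.+1] keeps the entry of index [n] and serves to place the
    sequence in $c_0$. *)
Definition c0_unit n : c0_seq R := c0_trunc n.+1 (fun k => (k == n)%:R).

Lemma c0_truncS N f : c0_trunc N.+1 f = f N *: c0_unit N + c0_trunc N f.
Proof.
apply/val_inj/funext => n.
rewrite -[RHS]/(f N * (if (n < N.+1)%N then (n == N)%:R else 0)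
                + (if (n < N)%N then f n else 0)) /= ltnS.
by case: ltngtP => [_|_|->]; rewrite ?mulr0 ?mulr1 ?add0r ?addr0.
Qed.

Lemma linear_c0_trunc (G : c0_seq R -> R) N f : linear (G : _ -> R^o) ->
  G (c0_trunc N f) = series (fun n => G (c0_unit n) * f n) N.
Proof.
move=> linG; elim: N => [|N IHN].
  rewrite /series /= big_geq //.
  have -> : c0_trunc 0 f = 0 by apply/val_inj.
  (* Linearity with scalar -1 at the zero vector yields [G 0 = 0]. *)
  by have := linG (-1) 0 0; rewrite scaler0 addr0 scaleN1r addNr.
rewrite c0_truncS linG IHN /series /= big_nat_recr //= addrC.
by congr (_ + _); exact: mulrC.
Qed.

Lemma pairing_c0_trunc (a : nat -> R) N f :
  pairing a (c0_trunc N f) = series (fun n => a n * f n) N.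
Proof.
apply: cvg_lim => //; apply: cvg_near_cst; exists N => // m /= Nm.
rewrite /series /= (big_cat_nat _ Nm) //= [X in _ + X]big1_seq ?addr0.
  by apply: eq_big_nat => i /andP[_ ->].
move=> i; rewrite mem_index_iota => /andP[_ /andP[Ni _]].
by rewrite ltnNge Ni mulr0.
Qed.

Lemma c0_trunc_norm_le1 N f : (forall n, `|f n| <= 1) -> `|c0_trunc N f| <= 1.
Proof.
move=> f1; apply: sup_norm_le => n /=.
by case: ifP => // _; rewrite normr0.
Qed.

(** The error is the tail of [b], uniformly small because [b] tends to 0. This density of finite
    sequences makes a continuous functional determined by its values on the unit vectors. *)
Lemma cvg_c0_trunc b : c0_trunc N b @[N --> \oo] --> b.
Proof.
apply/cvgrPdist_le => e e0.
have [N _ bN] := (cvgr0Pnorm_le _).1 (c0_seqP _ b) e e0.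
exists N => // m /= Nm; apply: sup_norm_le => n.
rewrite -[X in `|X|]/(b n - (if (n < m)%N then b n else 0)).
case: ltnP => [_|mn]; first by rewrite subrr normr0 ltW.
by rewrite subr0 bN //= (leq_trans Nm).
Qed.

Definition ell1_functional a b : R := pairing a b.

Lemma ell1_functional_linear a : linear (ell1_functional a : _ -> R^o).
Proof.
move=> k b b'; rewrite /ell1_functional !(pairingC a).
by apply: pairing_linear; apply: cvgP; rewrite series_mulC;
  apply: cvg_pairing (ell1_seqP _ a) (c0_seqP _ _).
Qed.

Lemma ell1_functional_le a b : `|ell1_functional a b| <= `|a| * `|b|.
Proof. exact: ler_pairing (ell1_seqP _ a) (c0_seqP _ b). Qed.

Lemma ell1_functional_continuous a : continuous (ell1_functional a).
Proof.
pose L := GRing.isLinear.Build R (c0_seq R) R^o _ _ (ell1_functional_linear a).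
pose f : {linear c0_seq R -> R^o} := HB.pack (ell1_functional a) L.
apply: (bounded_linear_continuous (f := f)); apply/linear_boundedP.
(* Any [r] above the norm of [a] is a bound for the functional. *)
near=> r => b; apply: le_trans (ell1_functional_le a b) _.
rewrite ler_wpM2r //; near: r; exact: nbhs_pinfty_ge.
Unshelve. all: by end_near. Qed.

Lemma continuous_dual_bounded {V : normedModType R} (G : V -> R) :
  continuous_dual G -> exists M, forall v, `|G v| <= M * `|v|.
Proof.
move=> [linG contG].
pose L := GRing.isLinear.Build R V R^o _ _ linG.
pose f : {linear V -> R^o} := HB.pack G L.
have /linear_boundedP/pinfty_ex_gt0[M _ fM] : bounded_near f (nbhs 0).
  by apply/linear_bounded_continuous.
by exists M.
Qed.

Lemma normed_series_sg (a : nat -> R) N :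
  series (fun n => a n * Num.sg (a n)) N = series (fun n => `|a n|) N.
Proof. by apply: eq_bigr => n _; rewrite mulrC -normrEsg. Qed.

Lemma sg_le1 (x : R) : `|Num.sg x| <= 1.
Proof. by rewrite normr_sg; case: eqP. Qed.

Lemma continuous_dual_ell1 (G : c0_seq R -> R) :
  continuous_dual G -> exists a, ell1_functional a = G.
Proof.
move=> dG; have [linG contG] := dG; have [M GM] := continuous_dual_bounded G dG.
pose a n := G (c0_unit n).
(* The sign of [M] is unknown, hence the absolute value: the bound must be nonnegative to absorb a
   vector of norm at most 1. *)
have [a1 _] : ell1 a /\ ell1_norm a <= `|M|.
  apply: normed_series_ub => N.
  rewrite -normed_series_sg -linear_c0_trunc // (le_trans (ler_norm _)) //.
  rewrite (le_trans (GM _)) // (le_trans (ler_wpM2r _ (ler_norm M))) //.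
  by rewrite ler_piMr // c0_trunc_norm_le1 // => n; exact: sg_le1.
exists (Ell1Seq _ a (asboolT a1)); apply/funext => b.
apply: cvg_lim => //.
(* The partial sums of the pairing are the values of [G] at the truncations of [b], so continuity of
   [G] identifies their limit. *)
rewrite (_ : series _ = (fun N => G (c0_trunc N b))).
  exact: cvg_comp (cvg_c0_trunc b) (contG b).
by apply/funext => N; rewrite linear_c0_trunc.
Qed.

Lemma ell1_functional_isometry : dual_isometry ell1_functional.
Proof.
split.
- move=> k a a'; apply/funext => b.
  by apply: pairing_linear; apply: cvgP;
    apply: cvg_pairing (ell1_seqP _ _) (c0_seqP _ b).
- apply/seteqP; split => [_ [a _ <-]|G /continuous_dual_ell1[a <-]].
    by split; [exact: ell1_functional_linear|exact: ell1_functional_continuous].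
  by exists a.
move=> a; rewrite /dual_norm; set S := (X in sup X).
have Sub : ubound S `|a|.
  move=> _ [b b1 <-]; rewrite (le_trans (ell1_functional_le a b)) //.
  by rewrite ler_piMr.
apply/eqP; rewrite eq_le; apply/andP; split.
  apply: ge_sup => //; exists `|ell1_functional a 0|, 0 => //=.
  by rewrite normr0.
(* For the reverse inequality, each partial sum of the [|a n|] is the value of the functional at a
   truncated sign sequence, which lies in the unit ball. *)
suff [] : ell1 a /\ ell1_norm a <= sup S by [].
apply: normed_series_ub => N; rewrite -normed_series_sg -pairing_c0_trunc.
apply: le_trans (ler_norm _) _; apply: ub_le_sup; first by exists `|a|.
exists (c0_trunc N (fun n => Num.sg (a n))) => //=.
by apply: c0_trunc_norm_le1 => n; exact: sg_le1.
Qed.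

End c0_dual.

(** * Function spaces obtained from expansions *)

Section expansions.
Context {R : realType} {X : ptopologicalType} (psi : nat -> X -> R).

Lemma L0_pairing (a : nat -> R) : (forall n, L0 (psi n)) ->
  (forall x, cvgn (series (fun n => a n * psi n x))) ->
  L0 (fun x => pairing a (psi^~ x)).
Proof.
move=> psiL cv.
apply: (measurable_fun_cvg
  (h := fun N (x : borel X) => series (fun n => a n * psi n x) N)); last first.
  by move=> x _; exact: cv.
move=> N; apply: measurable_sum => n.
by apply: measurable_funM => //; exact: psiL.
Qed.

(** [coef] reads a vector as its coefficient sequence. The section is applied to $c_0$ with [phi']
    and to $\ell^1$ with [phi]. *)
Context {V : normedModType R} (coef : V -> nat -> R).
Variables (A : set (nat -> R)) (p : (nat -> R) -> R).
Hypotheses (coef_linear : linear coef) (coef_range : range coef = A).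
Hypotheses (coef_norm : forall v, p (coef v) = `|v|).
Hypothesis coef_cvg : forall v x, cvgn (series (fun n => coef v n * psi n x)).
Hypothesis psi_L0 : forall n, L0 (psi n).
Hypothesis p_wd : norm_well_defined psi A p.

Let ev v x := pairing (coef v) (psi^~ x).

Let coefA v : A (coef v). Proof. by rewrite -coef_range; exists v. Qed.

Let ev_expands v : expands psi (coef v) (ev v).
Proof. by move=> x; exact: coef_cvg. Qed.

Let ev_linear : linear (ev : V -> X -> R^o).
Proof.
move=> k v w; apply/funext => x; rewrite /ev coef_linear.
exact: pairing_linear.
Qed.

Lemma expansion_function_space : function_space ev.
Proof.
split => //.
  (* Well-definedness equates norms only, not coefficients, so it is applied to [v - w] against 0
     rather than to [v] against [w]. *)
  move=> v w vw; apply/eqP; rewrite -subr_eq0 -normr_eq0 -coef_norm.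
  have ev0 : ev (v - w) = ev 0.
    have evB u u' : ev (u - u') = -1 *: (ev u' : X -> R^o) + ev u.
      by rewrite addrC -scaleN1r ev_linear.
    by rewrite -(subrr v) !evB vw.
  rewrite (p_wd _ _ _ (coefA _) (coefA 0) (ev_expands _)) ?coef_norm ?normr0 //.
  by rewrite ev0.
by move=> _ [v _ <-]; apply: L0_pairing.
Qed.

Lemma expansion_spaceE : range ev = expansion_space psi A.
Proof.
apply/seteqP; split => [_ [v _ <-]|g [a]]; first by exists (coef v).
rewrite -coef_range => -[v _ <-] vg; exists v => //; apply/funext => x.
by apply: cvg_lim => //; exact: vg.
Qed.

Lemma expansion_normE v : `|v| = expansion_norm psi A p (ev v).
Proof.
(* The default of [xget] never arises, since [coef v] is itself an admissible choice; any other
   choice has the same norm. *)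
rewrite /expansion_norm -coef_norm; case: xgetP => [a _ [Aa av]|none].
  exact: p_wd _ _ _ (coefA v) Aa (ev_expands v) av.
by have := none (coef v); case; split.
Qed.

End expansions.

(** * Assembly of the reproducing kernel space *)

Theorem theorem3p21 (R : realType) (Omega Omega' : ptopologicalType)
    (mu : {measure set (borel Omega) -> \bar R})
    (mu' : {measure set (borel Omega') -> \bar R})
    (K : Omega * Omega' -> R)
    (phi : nat -> Omega -> R) (phi' : nat -> Omega' -> R)
    (Omega_hausdorff : hausdorff_space Omega)
    (Omega_lc : locally_compact [set: Omega])
    (Omega'_hausdorff : hausdorff_space Omega')
    (Omega'_lc : locally_compact [set: Omega'])
    (mu_regular : regular_measure mu)
    (mu'_regular : regular_measure mu')
    (K_mercer : generalized_mercer K phi phi')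
    (phi_free : linearly_independent phi)
    (phi'_free : linearly_independent phi')
    (phi_summable : forall x, cvgn [normed series (fun n => phi n x)])
    (phi'_summable : forall y, cvgn [normed series (fun n => phi' n y)])
    (Binf_phi'_norm_wd : norm_well_defined phi' (@c0 R) (@sup_norm R))
    (B1_phi_norm_wd : norm_well_defined phi (@ell1 R) (@ell1_norm R)) :
  two_sided_RKBS (Binf phi') (Binf_norm phi') (adjoint_kernel K).
Proof.
have [K_L0 phi_L0 phi'_L0 KE] := K_mercer.
pose c0_coef : c0_seq R -> nat -> R := @c0_val R.
pose ell1_coef : ell1_seq R -> nat -> R := @ell1_val R.
have c0_range : range c0_coef = @c0 R.
  apply/seteqP; split => [_ [b _ <-]|b b0]; first exact: c0_seqP.
  by exists (C0Seq _ b (asboolT b0)).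
have ell1_range : range ell1_coef = @ell1 R.
  apply/seteqP; split => [_ [a _ <-]|a a1]; first exact: ell1_seqP.
  by exists (Ell1Seq _ a (asboolT a1)).
have c0_cvg b y : cvgn (series (fun n => c0_coef b n * phi' n y)).
  rewrite series_mulC; apply: cvgP.
  exact: cvg_pairing (phi'_summable y) (c0_seqP _ b).
have ell1_cvg a x : cvgn (series (fun n => ell1_coef a n * phi n x)).
  apply: cvgP.
  exact: cvg_pairing (ell1_seqP _ a) (ell1_c0 _ (phi_summable x)).
pose ev (b : c0_seq R) y := pairing (c0_coef b) (phi'^~ y).
pose ev' (a : ell1_seq R) x := pairing (ell1_coef a) (phi^~ x).
have evF : function_space ev.
  by apply: (expansion_function_space _ c0_coef _ _ _ c0_range _ _ _
    Binf_phi'_norm_wd).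
have ev'F : function_space ev'.
  by apply: (expansion_function_space _ ell1_coef _ _ _ ell1_range _ _ _
    B1_phi_norm_wd).
(* Coefficient sequences of the kernel sections: summability of [phi'] puts one in $\ell^1$, that of
   [phi] puts the other in $\ell^1$, hence in $c_0$. *)
pose phi'_at y := Ell1Seq R (phi'^~ y) (asboolT (phi'_summable y)).
pose phi_at x := C0Seq R (phi^~ x) (asboolT (ell1_c0 _ (phi_summable x))).
have ev'_phi' y : ev' (phi'_at y) = (fun x => adjoint_kernel K (y, x)).
  apply/funext => x; rewrite /ev' pairingC; apply: cvg_lim => //; exact: KE.
have ev_phi x : ev (phi_at x) = (fun y => adjoint_kernel K (y, x)).
  by apply/funext => y; apply: cvg_lim => //; exact: KE.
split.
  apply: measurableT_comp K_L0 _; exact: measurable_swap.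
exists (c0_seq R), ev; split => //.
- exact: expansion_spaceE.
- by move=> b; apply: (expansion_normE _ _ _ _ c0_range).
exists (ell1_seq R), ev', (@ell1_functional R); split => //.
  exact: ell1_functional_isometry.
split.
- by move=> y; exists (phi'_at y).
(* Injectivity of the evaluation forces [g] to be [phi'_at y]; both sides are then the same pairing
   up to the order of the factors. *)
- move=> y g gE f; have [_ ev'_inj _] := ev'F.
  by rewrite (ev'_inj g (phi'_at y)) ?ev'_phi' // /ell1_functional pairingC.
- by move=> x; exists (phi_at x).
(* Likewise [f] must be [phi_at x], and pairing [g] with it is by definition [ev' g x]. *)
- move=> x f fE g; have [_ ev_inj _] := evF.
  by rewrite (ev_inj f (phi_at x)) ?ev_phi.
Qed.
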